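(* Let $\mathcal B$ be a random partition of unity and $\mathcal A$ the associated self-similar partition (defined in the context). For $k\ge1$ and $u>0$ set $\phi_k(u)=\Pr(\mathcal A_k\le 1/u)$ (so $\phi_k=1$ on $(0,1]$, and $\phi_k(0):=1$). Then for every $k\ge1$ and $u>0$, $$\phi_k(u)=\frac1u\sum_{j=0}^{k-1}\mathbb E_{\mathcal B}\int_{(u-1/\mathcal B_{j+1})\vee 0}^{\,u-1/\mathcal B_j}\phi_{k-j}(y)\,dy,$$ equivalently $$u\,\phi_k(u)=\sum_{j=0}^{k-1}(S_j*\phi_{k-j})(u)=\sum_{j=0}^{k-1}\int_0^u S_j(t)\phi_{k-j}(u-t)\,dt,\qquad S_j(x)=\Pr\!\left(\mathcal B_{j+1}\le \tfrac1x<\mathcal B_j\right).$$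
   Context: A partition of unity is a nonnegative sequence summing to $1$; $\mathcal P_k$ denotes the $k$-th largest part of a partition $\mathcal P$, with conventions $\mathcal P_j=\infty$ for $j\le0$, $\mathcal P_k=0$ if $k$ exceeds the number of nonzero parts, $1/0=\infty$, $1/\infty=0$, and an integral $\int_a^b$ with $b\le a$ equals $0$. Given $\mathcal B$: let $U_1,U_2,\dots$ iid uniform on $[0,1]$, $V_i=U_i\prod_{r<i}(1-U_r)$, and $\mathcal B^{(1)},\mathcal B^{(2)},\dots$ iid copies of $\mathcal B$ independent of the $U$'s; $\mathcal A$ is the partition with parts $V_i\mathcal B^{(i)}_j$, $i,j\ge1$, so that $\mathcal A\overset d=(U\mathcal B,(1-U)\mathcal A)$ with $U$ uniform and $U,\mathcal B,\mathcal A$ independent on the right. *)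

(* Defs.v *)
From HB Require Import structures.
From mathcomp Require Import all_boot all_order all_algebra.
From mathcomp Require Import all_classical all_reals all_analysis.
Set Implicit Arguments. Unset Strict Implicit. Unset Printing Implicit Defensive.
Import Order.TTheory GRing.Theory Num.Theory.
Local Open Scope classical_set_scope.
Local Open Scope ring_scope.

Definition partition_of_unity (R : realType) (p : nat -> R) : Prop :=
  (forall i, 0 <= p i) /\ (\sum_(i <oo) (p i)%:E = 1%E)%E.

(* k-th largest part (k >= 1), counted with multiplicity, of a family of
   nonnegative parts indexed by I; it is 0 if there are fewer than k nonzero
   parts.  (The conventions P_0 = oo and 1/0 = oo are handled explicitly
   where they are used below.) *)
Definition kth_part (R : realType) (I : eqType) (p : I -> R) (k : nat) : R :=
  sup ([set 0] `|` [set x | 0 < x /\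
        exists s : seq I, [/\ uniq s, size s = k & all (fun i => x <= p i) s]]).

Section prob.
Context (R : realType) (d : measure_display) (Omega : measurableType d)
        (P : probability Omega R).

Definition uniform01 (U : Omega -> R) : Prop :=
  measurable_fun setT U /\
  forall x : R, 0 <= x <= 1 -> P [set w | U w <= x] = x%:E.

Definition cyl (Y : Omega -> nat -> R) (s : seq (nat * R)) : set Omega :=
  [set w | all (fun t => Y w t.1 <= t.2) s].

Definition same_law (X Y : Omega -> nat -> R) : Prop :=
  forall s : seq (nat * R), P (cyl X s) = P (cyl Y s).

(* mutual independence of a family of random sequences: product rule over
   every finite subfamily of distinct indices, for cylinder events (which
   generate the sigma-algebras of the random sequences) *)
Definition mutually_independent (I : eqType) (Y : I -> Omega -> nat -> R) :
    Prop :=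
  forall (ix : seq I) (E : I -> seq (nat * R)), uniq ix ->
    P (\bigcap_(i in [set i | i \in ix]) cyl (Y i) (E i)) =
    (\prod_(i <- ix) P (cyl (Y i) (E i)))%E.

Definition UB_family (U : nat -> Omega -> R) (Bs : nat -> Omega -> nat -> R)
    (x : nat + nat) : Omega -> nat -> R :=
  match x with inl i => fun w _ => U i w | inr i => Bs i end.

Definition Vw (U : nat -> Omega -> R) (i : nat) (w : Omega) : R :=
  U i w * \prod_(r < i) (1 - U r w).

Definition Apart (U : nat -> Omega -> R) (Bs : nat -> Omega -> nat -> R)
    (w : Omega) : nat * nat -> R :=
  fun ij => Vw U ij.1 w * Bs ij.1 w ij.2.

Definition phi (A : Omega -> nat * nat -> R) (k : nat) (u : R) : R :=
  if u <= 0 then 1 else fine (P [set w | kth_part (A w) k <= u^-1]).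

(* S_j(x) = P(B_{j+1} <= 1/x < B_j), with B_0 = oo *)
Definition Sfun (B : Omega -> nat -> R) (j : nat) (x : R) : R :=
  fine (P [set w | kth_part (B w) j.+1 <= x^-1 /\
                   (j = 0%N \/ x^-1 < kth_part (B w) j)]).

(* lower limit (u - 1/B_{j+1}) v 0, with 1/0 = oo *)
Definition lo_lim (B : Omega -> nat -> R) (u : R) (j : nat) (w : Omega) : R :=
  if 0 < kth_part (B w) j.+1 then Num.max (u - (kth_part (B w) j.+1)^-1) 0
  else 0.

(* upper limit u - 1/B_j, with 1/B_0 = 0 and (if B_j = 0) u - 1/0 = -oo,
   the latter represented by -1 (below the lower limit, so the integral is 0) *)
Definition hi_lim (B : Omega -> nat -> R) (u : R) (j : nat) (w : Omega) : R :=
  if j == 0%N then u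
  else if 0 < kth_part (B w) j then u - (kth_part (B w) j)^-1 else -1.

End prob.

(* Main.v *)
Require Import Defs.
From HB Require Import structures.
From mathcomp Require Import all_boot all_order all_algebra.
From mathcomp Require Import all_classical all_reals all_analysis.
From mathcomp Require Import measurable_realfun.
Import Order.TTheory GRing.Theory Num.Theory.
Local Open Scope classical_set_scope.
Local Open Scope ring_scope.

(* Let N_p(x) be the number of parts of p exceeding x, so that A_k <= 1/u iff
   N_A(1/u) < k.  The first stick gives A = (U_0 B^(0), (1 - U_0) A') with A'
   built from the shifted families, hence with T = u U_0
     N_A(1/u) = N_{B^(0)}(1/T) + N_{A'}(1/(u - T)).
   Now T is uniform on [0, u], and T, B^(0), A' are independent with A' equal in
   law to A.  Splitting {N_A(1/u) < k} according to j = N_{B^(0)}(1/T) < k and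
   integrating over T gives the convolution formula.  The other formula follows
   by Fubini, because 1/B_j < u - y <= 1/B_{j+1} describes the interval of
   integration. *)

(** The identity for A is pathwise, but the hypotheses give only laws and independence, and only on
    cylinder events. The U's and B's are therefore gathered into one family indexed by [nat + nat].
    Cylinder statements are extended to all measurable events by pi-system arguments, and the
    pathwise identity is used off a null set, because the copies B^(i) are bounded by 1 only almost
    surely. N_p(x) never appears as a number: it may be infinite for an arbitrary family, so
    [atleast p x k] states N_p(x) >= k through a list of distinct indices. Such an event is a
    countable union of finite intersections, hence measurable. The recursion is integrated in two
    stages. T depends on U_0 alone and is independent of all the rest; for T frozen at t, the rest
    splits into B^(0) and the family with both indices shifted. At t = u the convention for [phi] at
    0 differs from the inverse of 0 in the event, so the integrals are compared on half-open
    intervals. *)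

Definition atleast {R : realType} {I : eqType} (p : I -> R) (x : R) (k : nat) :=
  exists s : seq I, [/\ uniq s, size s = k & all (fun i => x < p i) s].

(** * Counting the parts above a level *)

Section counting.
Context {R : realType}.

Lemma atleast_count_leq {I : eqType} {p : I -> R} {x : R} {a b : nat} :
  (a <= b)%N -> atleast p x b -> atleast p x a.
Proof.
move=> ab [s [us ss ps]]; exists (take a s); split.
- exact: take_uniq.
- by rewrite size_takel ?ss.
- apply/allP => i /mem_take; exact: (allP ps).
Qed.

Lemma kth_part_ge0 {I : eqType} (p : I -> R) k : 0 <= kth_part p k.
Proof.
rewrite /kth_part; set A := (X in sup X).
have [hA|hA] := pselect (has_sup A); last by rewrite sup_out.
by apply: (ub_le_sup hA.2); left.
Qed.

(* The supremum of an unbounded set is 0, whence the first disjunct. *)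
Lemma kth_part_leP {I : eqType} (p : I -> R) k x :
  kth_part p k <= x <->
  0 <= x /\ ((forall n : nat, atleast p n%:R k) \/ ~ atleast p x k).
Proof.
rewrite /kth_part; set A := (X in sup X).
have A0 : A 0 by left.
have [Hall|Hn] := pselect (forall n : nat, atleast p n%:R k).
  have nhA : ~ has_sup A.
    move=> [_ [M uM]]; pose n := (Num.truncn `|M|).+1.
    have Mn : M < n%:R by rewrite (le_lt_trans (ler_norm _))// truncnS_gt.
    suff /uM : A n%:R by rewrite leNgt Mn.
    right; split; first by rewrite ltr0n.
    have [s [us ss ps]] := Hall n; exists s; split => //.
    by apply: sub_all ps => i /ltW.
  by rewrite sup_out//; split => [x0|[]//]; split => //; left.
have hA : has_sup A.
  split; first by exists 0.
  have [n hn] : exists n : nat, ~ atleast p n%:R k by apply/existsNP.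
  exists n%:R => y [->|[y0 [s [us ss ps]]]]; first by rewrite ler0n.
  rewrite leNgt; apply/negP => ny; apply: hn.
  exists s; split => //.
  by apply: sub_all ps => i; exact: lt_le_trans.
split.
  move=> Ax; split; first by apply: le_trans Ax; apply: (ub_le_sup hA.2).
  right => -[s [us ss ps]].
  suff [y [xy Ay]] : exists y, x < y /\ A y.
    have := ub_le_sup hA.2 Ay => yA.
    by have := lt_le_trans xy (le_trans yA Ax); rewrite ltxx.
  have x0 : 0 <= x by apply: le_trans Ax; apply: (ub_le_sup hA.2).
  (* A finite minimum of parts exceeding [x] still exceeds [x], so it is an element of the set whose
     supremum is at most [x]. The default [x + 1] covers the empty list. *)
  pose y := \big[Num.min/(x + 1)]_(i <- s) p i.
  have xy : x < y.
    rewrite /y; elim: (s) (ps) => [_|i r IH /= /andP[xi xr]].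
      by rewrite big_nil ltrDl.
    by rewrite big_cons lt_min xi IH.
  exists y; split => //; right; split; first exact: le_lt_trans xy.
  exists s; split => //; apply/allP => i si.
  rewrite /y; elim: (s) si => // i' r IH; rewrite inE big_cons => /orP[/eqP <-|ir].
    by rewrite ge_min lexx.
  by rewrite ge_min IH ?orbT.
move=> [x0 [//|hx]]; apply: ge_sup; first by exists 0.
move=> y [->//|[y0 [s [us ss ps]]]].
rewrite leNgt; apply/negP => xy; apply: hx; exists s; split => //.
by apply: sub_all ps => i; exact: lt_le_trans.
Qed.

(** A bound on the parts excludes the degenerate supremum. For [k = 0] the empty list reaches every
    level, so that case would be unbounded even for bounded [p]. *)
Lemma bounded_kth_part_leP {I : eqType} (p : I -> R) (M : R) k x :
  (forall i, p i <= M) -> (0 < k)%N -> 0 <= x ->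
  (kth_part p k <= x <-> ~ atleast p x k).
Proof.
move=> pM k0 x0; rewrite kth_part_leP; split; last by move=> h; split => //; right.
move=> [_ [/(_ (Num.truncn `|M|).+1) [s [us ss ps]]|//]].
case: s ss us ps => [|i s] /= ss; first by rewrite -ss in k0.
move=> _ /andP[+ _]; rewrite ltNge => /negP[]; rewrite (le_trans (pM i))//.
by rewrite (le_trans (ler_norm M))// ltW// truncnS_gt.
Qed.

Lemma atleast_scale {I : eqType} (p : I -> R) (c x : R) k : 0 < c ->
  atleast (fun i => c * p i) x k <-> atleast p (x / c) k.
Proof.
move=> c0; split => -[s [us ss ps]]; exists s; split => //; move: ps;
  by congr is_true; apply: eq_all => i; rewrite ltr_pdivrMr// mulrC.
Qed.

(** Additivity of the count over row 0 and the other rows: a list of indices is filtered by row in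
    one direction, and two lists are concatenated in the other. *)
Lemma atleast_split (p : nat * nat -> R) x k :
  atleast p x k <-> exists a b, [/\ (a + b)%N = k,
    atleast (fun j => p (0%N, j)) x a & atleast (fun ij => p (ij.1.+1, ij.2)) x b].
Proof.
split.
  move=> [s [us ss ps]].
  pose P0 := fun ij : nat * nat => ij.1 == 0%N.
  pose s0 := [seq ij <- s | P0 ij]; pose s1 := [seq ij <- s | ~~ P0 ij].
  exists (size s0), (size s1); split.
  - by rewrite !size_filter -ss count_predC.
  - exists (map snd s0); split; last 2 first.
    + by rewrite size_map.
    + apply/allP => j /mapP[[i j'] /=]; rewrite mem_filter => /andP[/eqP/= -> sij ->].
      exact: (allP ps).
    rewrite map_inj_in_uniq ?filter_uniq//.
    move=> [i j] [i' j']; rewrite !mem_filter /P0/=.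
    by move=> /andP[/eqP-> _] /andP[/eqP-> _] ->.
  - exists (map (fun ij => (ij.1.-1, ij.2)) s1); split; last 2 first.
    + by rewrite size_map.
    + apply/allP => ij /mapP[[i j] /=]; rewrite mem_filter => /andP[i0 sij -> /=].
      by rewrite prednK ?lt0n//; exact: (allP ps).
    rewrite map_inj_in_uniq ?filter_uniq//.
    move=> [[|i] j] [[|i'] j']; rewrite !mem_filter /P0//=.
    by move=> _ _ [-> ->].
move=> [a [b [<- [s0 [u0 ss0 p0]] [s1 [u1 ss1 p1]]]]].
exists (map (fun j => (0%N, j)) s0 ++ map (fun ij => (ij.1.+1, ij.2)) s1); split.
- rewrite cat_uniq !map_inj_uniq ?u0 ?u1 ?andbT/=.
  + apply/hasP => -[ij /mapP[ij1 _ ->] /mapP[j _]]//.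
  + by move=> [i j] [i' j'] /= [-> ->].
  + by move=> j j' [].
- by rewrite size_cat !size_map ss0 ss1.
- rewrite all_cat !all_map; apply/andP; split.
    by apply: sub_all p0.
  by apply: sub_all p1.
Qed.

(** Here [j] is the exact count in row 0, rather than a lower bound, so that different [j] give
    disjoint events. *)
Lemma no_atleast_splitP (p : nat * nat -> R) x k :
  ~ atleast p x k <->
  exists2 j, (j < k)%N & [/\ atleast (fun j => p (0%N, j)) x j,
    ~ atleast (fun j => p (0%N, j)) x j.+1 &
    ~ atleast (fun ij => p (ij.1.+1, ij.2)) x (k - j)].
Proof.
pose p0 j := p (0%N, j); pose p1 (ij : nat * nat) := p (ij.1.+1, ij.2).
rewrite -/p0 -/p1; split; last first.
  move=> [j jk [_ h0 h1]] /atleast_split[a [b [abk pa pb]]].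
  have [aj|ja] := leqP a j; last exact: h0 (atleast_count_leq ja pa).
  apply: h1; apply: (atleast_count_leq _ pb).
  by rewrite leq_subLR -abk leq_add2r.
move=> nk.
have at0 : atleast p0 x 0 by exists [::].
have nk0 : ~ atleast p0 x k.
  move=> h; apply: nk; apply/atleast_split; exists k, 0%N; split => //.
    by rewrite addn0.
  by exists [::].
have [j jk [h0 h1]] : exists2 j, (j < k)%N & atleast p0 x j /\ ~ atleast p0 x j.+1.
  elim: k nk0 {nk} => // k IH nk.
  have [h|/IH[j jk h]] := pselect (atleast p0 x k); first by exists k.
  by exists j => //; exact: leqW.
exists j => //; split => // h; apply: nk; apply/atleast_split.
by exists j, (k - j)%N; split => //; rewrite subnKC// ltnW.
Qed.

End counting.

(** * Measurability of the counting events *)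

Section counting_measurable.
Context {R : realType} {d : measure_display} {T : measurableType d}.
Implicit Types (I : countType).

(** There are countably many lists over a countable index type. The level [x] may vary with the
    point: with a product space as [T], this yields the joint measurability that Fubini requires. *)
Lemma measurable_atleast I (p : T -> I -> R) (x : T -> R) k :
  (forall i, measurable_fun setT (p ^~ i)) -> measurable_fun setT x ->
  measurable [set w | atleast (p w) (x w) k].
Proof.
move=> mp mx.
pose F (s : seq I) := [set w | uniq s /\ size s = k /\ all (fun i => x w < p w i) s].
have -> : [set w | atleast (p w) (x w) k] = \bigcup_s F s.
  apply/seteqP; split => [w [s [us ss ps]]|w [s _ [us [ss ps]]]].
    by exists s.
  by exists s.
apply: countable_bigcupT_measurable => // s; rewrite /F.
have [us|nus] := boolP (uniq s); last first.
  by rewrite (_ : [set w | _] = set0)//; apply/seteqP; split => // w [].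
have [/eqP ss|nss] := boolP (size s == k); last first.
  rewrite (_ : [set w | _] = set0)//; apply/seteqP; split => // w [_ [/eqP]].
  by rewrite (negbTE nss).
rewrite (_ : [set w | _] = [set w | all (fun i => x w < p w i) s]); last first.
  by apply/seteqP; split => [w [_ []]|w].
elim: s {us ss} => [|i s IH] /=; first by rewrite (_ : [set w | _] = setT)//; apply/seteqP; split.
rewrite (_ : [set w | _] = [set w | x w < p w i] `&`
    [set w | all (fun i => x w < p w i) s]); last first.
  by apply/seteqP; split => w /= /andP.
apply: measurableI => //.
have := measurable_fun_ltr mx (mp i) => /(_ measurableT [set true]).
by rewrite setTI; apply.
Qed.

Lemma measurable_kth_part_le I (p : T -> I -> R) (x : T -> R) k :
  (forall i, measurable_fun setT (p ^~ i)) -> measurable_fun setT x ->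
  measurable [set w | kth_part (p w) k <= x w].
Proof.
move=> mp mx.
rewrite (_ : [set w | _] = [set w | 0 <= x w] `&`
  ((\bigcap_n [set w | atleast (p w) n%:R k]) `|`
     ~` [set w | atleast (p w) (x w) k])); last first.
  apply/seteqP; split => w /=.
    by move/kth_part_leP => [x0 [h|h]]; split => //; [left => n _; exact: h|right].
  by move=> [x0 h]; apply/kth_part_leP; split => //; case: h => h; [left => n; exact: h|right].
apply: measurableI.
  have := measurable_fun_ler (measurable_cst (0 : R)) mx => /(_ measurableT [set true]).
  by rewrite setTI; apply.
apply: measurableU.
  by apply: bigcapT_measurable => n; apply: measurable_atleast.
by apply: measurableC; apply: measurable_atleast.
Qed.

End counting_measurable.

(** * From a generating pi-system to the whole sigma-algebra *)

Section pi_system_extension.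
Context {R : realType} {d d' : measure_display} {T : measurableType d}
  {S : measurableType d'}.
Variables (P : probability T R) (G : set (set S)).
Hypotheses (mG : measurable = <<s G>>) (GI : setI_closed G) (GT : G setT).

Lemma eq_law_pi_system (X Y : T -> S) (mX : measurable_fun setT X)
    (mY : measurable_fun setT Y) :
  (forall A, G A -> P (X @^-1` A) = P (Y @^-1` A)) ->
  forall A, measurable A -> P (X @^-1` A) = P (Y @^-1` A).
Proof.
move=> h A mA.
have := @measure_unique _ R S G (fun=> setT) mG GI (fun=> GT) _
  (pushforward P X) (pushforward P Y).
apply => //.
  by apply/seteqP; split => // x _; exists 0%N.
by move=> _; rewrite /= /pushforward preimage_setT probability_setT ltry.
Qed.

(** With [F] fixed, both sides are finite measures in [A]: the image under [X] of [P] restricted to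
    [F], and the law of [X] scaled by [P F]. They agree on [G], hence everywhere. *)
Lemma indep_pi_system (X : T -> S) (mX : measurable_fun setT X) (F : set T) :
  measurable F ->
  (forall A, G A -> P (X @^-1` A `&` F) = (P (X @^-1` A) * P F)%E) ->
  forall A, measurable A -> P (X @^-1` A `&` F) = (P (X @^-1` A) * P F)%E.
Proof.
move=> mF h A mA.
have PF : P F = (fine (P F))%:E by rewrite fineK ?fin_num_measure.
have PF0 : 0 <= fine (P F) by rewrite fine_ge0.
have := @measure_unique _ R S G (fun=> setT) mG GI (fun=> GT) _
  (pushforward (mrestr P mF) X) (mscale (NngNum PF0) (pushforward P X)).
rewrite /= /mscale /pushforward /mrestr /= -PF => e; rewrite e ?(muleC (P F))//.
- by apply/seteqP; split => // x _; exists 0%N.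
- by move=> B GB; rewrite h// muleC.
- by move=> _; rewrite preimage_setT setTI -ge0_fin_numE ?fin_num_measure.
Qed.

End pi_system_extension.

(** * Open rays of the line and cylinders of sequence space *)

Lemma RGenOInfty_setI_closed (R : realType) : setI_closed (@RGenOInfty.G R).
Proof.
move=> _ _ [x ->] [y ->]; exists (Num.max x y).
by apply/seteqP; split => z /=; rewrite !in_itv/= !andbT gt_max => /andP.
Qed.

Definition cylinders (R : realType) (J : eqType) : set (set (J -> R)) :=
  range (fun s : seq (J * R) => [set y | all (fun t => y t.1 <= t.2) s]).

Section seq_space.
Context {R : realType} {J : eqType}.

Lemma cylinders_setI_closed : setI_closed (cylinders R J).
Proof.
move=> _ _ [s _ <-] [t _ <-]; exists (s ++ t) => //.
by apply/seteqP; split => y /=; rewrite all_cat => /andP.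
Qed.

Lemma cylindersT : cylinders R J setT.
Proof. by exists [::] => //; apply/seteqP; split. Qed.

(** The cylinders are exactly the sets on which [same_law] and [mutually_independent] are
    formulated; they form the generating pi-system. *)
Definition seq_space := g_sigma_algebraType (cylinders R J : set (set (J -> measurableTypeR R))).

Lemma measurable_coord (j : J) : measurable_fun setT (fun y : seq_space => y j).
Proof.
apply: (measurability _ (RGenOInfty.measurableE R)) => _ [_ [x ->] <-].
rewrite setTI (_ : _ @^-1` _ = ~` [set y : seq_space | y j <= x]).
  apply: measurableC; apply: sub_sigma_algebra; exists [:: (j, x)] => //.
  by apply/seteqP; split => y /=; rewrite andbT.
by apply/seteqP; split => y /=; rewrite in_itv/= andbT ltNge => /negP.
Qed.

Lemma measurable_to_seq_space d (T : measurableType d) (X : T -> seq_space) :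
  (forall j, measurable_fun setT (X ^~ j)) -> measurable_fun setT X.
Proof.
move=> mX; apply: (@measurability _ _ _ seq_space _ _ (cylinders R J) erefl)
  => _ [_ [s _ <-] <-]; rewrite setTI.
elim: s => [|t s IH] /=; first by rewrite (_ : _ @^-1` _ = setT)//; apply/seteqP; split.
rewrite (_ : _ @^-1` _ = [set w | X w t.1 <= t.2] `&`
   X @^-1` [set y | all (fun t => y t.1 <= t.2) s]); last first.
  by apply/seteqP; split => w /= /andP.
apply: measurableI => //.
have := measurable_fun_ler (mX t.1) (measurable_cst t.2) => /(_ measurableT [set true]).
by rewrite setTI; apply.
Qed.

End seq_space.
Arguments seq_space : clear implicits.

(** * Joint laws of subfamilies of an independent family *)

Section blocks.
Context {R : realType} {d : measure_display} {Omega : measurableType d}.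
Variable P : probability Omega R.

(** The subfamily selected by [g], flattened into one random element. Relabelling by [L] lets two
    different subfamilies be compared in the same space. *)
Definition block {L I : eqType} (Y : I -> Omega -> nat -> R) (g : L -> I) (w : Omega)
  : seq_space R (L * nat)%type := fun c => Y (g c.1) w c.2.

Lemma measurable_block {L I : eqType} (Y : I -> Omega -> nat -> R) (g : L -> I) :
  (forall i j, measurable_fun setT (fun w => Y i w j)) -> measurable_fun setT (block Y g).
Proof. by move=> mY; apply: measurable_to_seq_space => -[l j]; exact: mY. Qed.

Definition constraints_at {I : eqType} (s : seq ((I * nat) * R)) (i : I) :=
  [seq (t.1.2, t.2) | t <- s & t.1.1 == i].

(** Grouping the constraints by sequence makes a joint cylinder an intersection of single cylinders.
    An index of [ix] without constraints contributes the full space, so [ix] may be larger than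
    necessary. *)
Lemma mutually_independent_cylinder {I : eqType} (Y : I -> Omega -> nat -> R)
    (s : seq ((I * nat) * R)) (ix : seq I) :
  mutually_independent P Y -> uniq ix -> {in s, forall t, t.1.1 \in ix} ->
  P [set w | all (fun t => Y t.1.1 w t.1.2 <= t.2) s] =
  (\prod_(i <- ix) P (cyl (Y i) (constraints_at s i)))%E.
Proof.
move=> iY uix six; rewrite -iY//; congr (P _); apply/seteqP; split => w /=.
  move=> /allP h i /= iix; rewrite /cyl/= all_map; apply/allP => t /=.
  by rewrite mem_filter => /andP[/eqP <-]; exact: h.
move=> h; apply/allP => t ts.
have := h _ (six _ ts); rewrite /cyl/= all_map => /allP; apply.
by rewrite mem_filter eqxx.
Qed.

Lemma preimage_block_cylinder {L I : eqType} (Y : I -> Omega -> nat -> R) (g : L -> I)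
    (s : seq ((L * nat) * R)) :
  block Y g @^-1` [set y | all (fun t => y t.1 <= t.2) s] =
  [set w | all (fun t => Y t.1.1 w t.1.2 <= t.2)
             [seq ((g t.1.1, t.1.2), t.2) | t <- s]].
Proof. by apply/seteqP; split => w /=; rewrite all_map. Qed.

Lemma block_indep {L1 L2 I : eqType} (Y : I -> Omega -> nat -> R) (g1 : L1 -> I)
    (g2 : L2 -> I) (A1 : set (seq_space R (L1 * nat)%type))
    (A2 : set (seq_space R (L2 * nat)%type)) :
  mutually_independent P Y -> (forall i j, measurable_fun setT (fun w => Y i w j)) ->
  (forall l1 l2, g1 l1 != g2 l2) -> measurable A1 -> measurable A2 ->
  P (block Y g1 @^-1` A1 `&` block Y g2 @^-1` A2) =
  (P (block Y g1 @^-1` A1) * P (block Y g2 @^-1` A2))%E.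
Proof.
move=> iY mY g12 mA1 mA2.
have mpre (L : eqType) (g : L -> I) (A : set (seq_space R (L * nat)%type)) :
    measurable A -> measurable (block Y g @^-1` A).
  by move=> mA; rewrite -[X in measurable X]setTI; exact: measurable_block.
apply: (@indep_pi_system R _ _ _ (seq_space R (L1 * nat)%type) P (cylinders R (L1 * nat)%type) erefl
  cylinders_setI_closed cylindersT (block Y g1) (measurable_block _ _ mY) _
  (mpre _ g2 _ mA2) _ _ mA1).
(* The extension lemma varies only its first factor, so the factors are exchanged to treat the
   second block in the same way. *)
move=> _ [s1 _ <-]; rewrite setIC muleC.
apply: (@indep_pi_system R _ _ _ (seq_space R (L2 * nat)%type) P (cylinders R (L2 * nat)%type) erefl
  cylinders_setI_closed cylindersT (block Y g2) (measurable_block _ _ mY) _ _ _ _ mA2).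
  by apply: mpre; apply: sub_sigma_algebra; exists s1.
move=> _ [s2 _ <-]; rewrite !preimage_block_cylinder.
set s1' := map _ s1; set s2' := map _ s2.
(* The ranges of [g1] and [g2] are disjoint, so [ix2 ++ ix1] has no repetition and the product rule
   for the concatenated constraints factors into the two blocks. *)
pose ix1 := undup [seq t.1.1 | t <- s1']; pose ix2 := undup [seq t.1.1 | t <- s2'].
have ix12 i : i \in ix1 -> i \in ix2 -> False.
  rewrite !mem_undup => /mapP[_ /mapP[t1 _ ->] ->] /mapP[_ /mapP[t2 _ ->]] /= /eqP.
  by apply/negP.
have hin (s : seq ((I * nat) * R)) : {in s, forall t, t.1.1 \in undup [seq t.1.1 | t <- s]}.
  by move=> t ts; rewrite mem_undup; apply/mapP; exists t.
have hout (s : seq ((I * nat) * R)) i : i \notin undup [seq t.1.1 | t <- s] ->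
    constraints_at s i = [::].
  rewrite mem_undup => h; rewrite /constraints_at (eq_in_filter (a2 := pred0)) ?filter_pred0//.
  by move=> t ts; apply/negP => /eqP ti; move/negP: h; apply; apply/mapP; exists t.
have u1 : uniq ix1 by exact: undup_uniq.
have u2 : uniq ix2 by exact: undup_uniq.
have h1 : {in s1', forall t, t.1.1 \in ix1} by exact: hin.
have h2 : {in s2', forall t, t.1.1 \in ix2} by exact: hin.
rewrite (mutually_independent_cylinder Y s1' ix1)// (mutually_independent_cylinder Y s2' ix2)//.
have -> : [set w | all (fun t => Y t.1.1 w t.1.2 <= t.2) s2'] `&`
   [set w | all (fun t => Y t.1.1 w t.1.2 <= t.2) s1'] =
   [set w | all (fun t => Y t.1.1 w t.1.2 <= t.2) (s2' ++ s1')].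
  by apply/seteqP; split => w /=; rewrite all_cat => /andP.
rewrite (mutually_independent_cylinder Y _ (ix2 ++ ix1))//; first last.
- by move=> t; rewrite !mem_cat => /orP[/h2->//|/h1->]; rewrite orbT.
- rewrite cat_uniq u1 u2 andbT/=; apply/hasP => -[i i1 i2].
  exact: ix12 i1 i2.
rewrite big_cat/=; congr (_ * _)%E; rewrite big_seq [RHS]big_seq; apply: eq_bigr => i iix;
  congr (P (cyl _ _)); rewrite /constraints_at filter_cat map_cat -!/(constraints_at _ _).
- by rewrite (hout s1') ?cats0//; apply/negP => /ix12; apply.
- by rewrite (hout s2')//; apply/negP => ?; apply: (ix12 i).
Qed.

(** On cylinders both laws are products of marginals that agree by assumption. Injectivity makes
    distinct labels select distinct members, as the product rule demands. *)
Lemma block_same_law {L I : eqType} (Y : I -> Omega -> nat -> R) (g1 g2 : L -> I)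
    (A : set (seq_space R (L * nat)%type)) :
  mutually_independent P Y -> (forall i j, measurable_fun setT (fun w => Y i w j)) ->
  injective g1 -> injective g2 -> (forall l, same_law P (Y (g1 l)) (Y (g2 l))) ->
  measurable A ->
  P (block Y g1 @^-1` A) = P (block Y g2 @^-1` A).
Proof.
move=> iY mY g1i g2i Yg mA.
apply: (@eq_law_pi_system R _ _ _ (seq_space R (L * nat)%type) P (cylinders R (L * nat)%type) erefl
  cylinders_setI_closed cylindersT _ _ (measurable_block _ _ mY) (measurable_block _ _ mY) _ _ mA).
move=> _ [s _ <-]; rewrite !preimage_block_cylinder.
pose ls := undup [seq t.1.1 | t <- s].
have E (g : L -> I) : injective g ->
  P [set w | all (fun t => Y t.1.1 w t.1.2 <= t.2)
             [seq ((g t.1.1, t.1.2), t.2) | t <- s]] =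
  (\prod_(l <- ls) P (cyl (Y (g l)) (constraints_at s l)))%E.
  move=> gi; rewrite (mutually_independent_cylinder Y _ (map g ls))//; first last.
  - move=> _ /mapP[t ts ->]/=; apply: map_f; rewrite mem_undup.
    by apply/mapP; exists t.
  - by rewrite map_inj_uniq ?undup_uniq.
  rewrite big_map; apply: eq_bigr => l _; congr (P (cyl _ _)).
  rewrite /constraints_at filter_map -map_comp; congr map.
  by apply: eq_filter => t /=; rewrite inj_eq.
by rewrite !E//; apply: eq_bigr => l _; exact: Yg.
Qed.

End blocks.

(** * Uniform laws from their distribution functions *)

Section uniform_law.
Context {R : realType} {d : measure_display} {Omega : measurableType d}.
Variable P : probability Omega R.

Lemma uniform_law (X : Omega -> R) (u : R) : 0 < u -> measurable_fun setT X ->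
  (forall x, 0 <= x <= u -> P [set w | X w <= x] = (x / u)%:E) ->
  forall A : set R, measurable A ->
    P (X @^-1` A) = ((u^-1)%:E * lebesgue_measure (A `&` `[0%R, u]%classic))%E.
Proof.
move=> u0 mX hX A mA.
have mi : measurable (`[0, u]%classic : set R) by [].
have u0' : 0 <= u^-1 by rewrite invr_ge0 ltW.
have mXR : measurable_fun setT (X : Omega -> measurableTypeR R) by exact: mX.
have mle x : measurable [set w | X w <= x].
  have := measurable_fun_ler mX (measurable_cst x) => /(_ measurableT [set true]).
  by rewrite setTI; apply.
suff : pushforward P (X : Omega -> measurableTypeR R) A =
    mscale (NngNum u0') (mrestr lebesgue_measure mi) A by [].
apply: (@measure_unique _ R (measurableTypeR R) (@RGenOInfty.G R)
  (fun n => `]- n%:R, +oo[%classic)) => //.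
- exact: RGenOInfty.measurableE.
- exact: RGenOInfty_setI_closed.
- by move=> n; exists (- n%:R).
- apply/seteqP; split => // x _; exists (Num.truncn `|x|).+1 => //=.
  rewrite in_itv/= andbT ltrNl (le_lt_trans (ler_norm _))// normrN.
  exact: truncnS_gt.
- move=> _ [x ->].
  change (P (X @^-1` `]x, +oo[%classic) =
    ((u^-1)%:E * lebesgue_measure (`]x, +oo[%classic `&` `[0%R, u]%classic))%E).
  have -> : X @^-1` `]x, +oo[%classic = ~` [set w | X w <= x].
    by apply/seteqP; split => w /=; rewrite in_itv/= andbT ltNge => /negP.
  rewrite probability_setC//.
  (* The hypothesis gives the distribution function on [[0, u]] only; monotonicity, from the values
     0 at [0] and 1 at [u], gives it outside. *)
  have [x0|x0] := ltP x 0.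
    have -> : P [set w | X w <= x] = 0%E.
      apply/eqP; rewrite eq_le measure_ge0 andbT.
      have <- : P [set w | X w <= 0] = 0%E by rewrite hX ?lexx ?ltW// mul0r.
      apply: le_measure; rewrite ?inE// => w /= h.
      exact: le_trans h (ltW x0).
    rewrite sube0 (_ : _ `&` _ = `[0, u]%classic); last first.
      apply/seteqP; split => y /=; rewrite !in_itv/= ?andbT; first by case.
      by move=> /andP[y0 yu]; split; [exact: lt_le_trans y0|rewrite y0].
    by rewrite lebesgue_measure_itv/= lte_fin u0 -EFinB -EFinM subr0 mulVf// gt_eqF.
  have [ux|xu] := leP u x.
    have -> : P [set w | X w <= x] = 1%E.
      apply/eqP; rewrite eq_le probability_le1//=.
      have <- : P [set w | X w <= u] = 1%E by rewrite hX ?lexx ?ltW// mulfV// gt_eqF.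
      apply: le_measure; rewrite ?inE// => w /=.
      by move=> h; apply: le_trans h ux.
    rewrite subee// (_ : _ `&` _ = set0) ?measure0 ?mule0//.
    apply/seteqP; split => y //=; rewrite !in_itv/= ?andbT => -[xy /andP[_ yu]].
    by move: xy; rewrite ltNge (le_trans yu).
  rewrite hX ?x0 ?ltW// (_ : _ `&` _ = `]x, u]%classic); last first.
    apply/seteqP; split => y /=; rewrite !in_itv/= ?andbT.
      by move=> [-> /andP[_ ->]].
    by move=> /andP[xy yu]; rewrite xy yu andbT (le_trans x0)// ltW.
  rewrite lebesgue_measure_itv/= lte_fin xu -!EFinB -EFinM; congr EFin.
  by rewrite mulrBr mulVf ?gt_eqF// mulrC.
- move=> k; rewrite /= /pushforward (le_lt_trans (probability_le1 P _)) ?ltry//.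
  by rewrite -[X in measurable X]setTI; apply: mX.
Qed.

(** A uniform variable enters the joint family as a constant sequence. All constraints of a cylinder
    then bear on one number, so the cylinder is the full space or a single ray ending at the least
    threshold. *)
Lemma same_law_uniform01 (X X' : Omega -> R) : uniform01 P X -> uniform01 P X' ->
  same_law P (fun w _ => X w) (fun w _ => X' w).
Proof.
move=> [mX hX] [mX' hX'] s.
have [E|[x E]] : (forall Z : Omega -> R, cyl (fun w (_ : nat) => Z w) s = setT) \/
   exists x, forall Z : Omega -> R, cyl (fun w (_ : nat) => Z w) s = Z @^-1` `]-oo, x].
- elim: s => [|[j x] s IH]; first by left => Z; apply/seteqP; split.
  right; case: IH => [h|[y h]].
    exists x => Z; apply/seteqP; split => w /=; rewrite /cyl/= in_itv/=.
      by case/andP.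
    by move=> ->/=; have : cyl (fun w (_ : nat) => Z w) s w by rewrite h.
  exists (Num.min x y) => Z; rewrite (_ : cyl _ _ = [set w | Z w <= x] `&`
      cyl (fun w (_ : nat) => Z w) s); last by apply/seteqP; split => w /= /andP.
  rewrite h; apply/seteqP; split => w /=; rewrite !in_itv/= le_min.
    by move=> [-> ->].
  by move=> /andP.
- by rewrite !E.
- by rewrite !E !(uniform_law _ 1)// => y y01; rewrite ?hX ?hX' ?divr1.
Qed.

End uniform_law.

Section inv.
Import numFieldNormedType.Exports.

(** Inversion is continuous away from 0, and the point 0 is split off as a measurable set. *)
Lemma measurable_invr {R : realType} : measurable_fun setT (fun x : R => x^-1).
Proof.
rewrite -(setvU [set (0 : R)]).
apply/measurable_funU; [exact: measurableC|by []|split; last exact: measurable_fun_set1].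
apply: open_continuous_measurable_fun.
  by rewrite openC; exact: closed_eq.
by move=> x; rewrite inE/= => /eqP x0; exact: inv_continuous.
Qed.

End inv.

(** * Conditioning on one of two independent variables *)

Section independent_pair.
Context {R : realType} {d d1 d2 : measure_display} {Omega : measurableType d}
  {T1 : measurableType d1} {T2 : measurableType d2}.
Variables (P : probability Omega R) (X1 : Omega -> T1) (X2 : Omega -> T2).
Hypotheses (mX1 : measurable_fun setT X1) (mX2 : measurable_fun setT X2).

Lemma measurable_probability_xsection (D : set (T1 * T2)) : measurable D ->
  measurable_fun setT (fun x => P (X2 @^-1` xsection D x)).
Proof.
move=> mD.
pose mX2' := isMeasurableFun.Build _ _ _ _ _ mX2.
pose X2' : {mfun _ >-> _} := HB.pack X2 mX2'.
exact: (@measurable_fun_xsection _ _ T1 T2 R (distribution P X2') D mD).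
Qed.

(** The product rule on rectangles identifies the law of the pair with the product measure, whose
    value on [D] is the integral of the measures of its sections. *)
Lemma probability_independent_pair (D : set (T1 * T2)) :
  (forall A1 A2, measurable A1 -> measurable A2 ->
    P (X1 @^-1` A1 `&` X2 @^-1` A2) = (P (X1 @^-1` A1) * P (X2 @^-1` A2))%E) ->
  measurable D ->
  P [set w | D (X1 w, X2 w)] = (\int[P]_w P (X2 @^-1` xsection D (X1 w)))%E.
Proof.
move=> X12 mD.
pose mX1' := isMeasurableFun.Build _ _ _ _ _ mX1.
pose X1' : {mfun _ >-> _} := HB.pack X1 mX1'.
pose mX2' := isMeasurableFun.Build _ _ _ _ _ mX2.
pose X2' : {mfun _ >-> _} := HB.pack X2 mX2'.
have mX : measurable_fun setT (fun w => (X1 w, X2 w)) by exact: measurable_fun_pair.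
pose mX' := isMeasurableFun.Build _ _ _ _ _ mX.
pose X' : {mfun _ >-> _} := HB.pack (fun w => (X1 w, X2 w)) mX'.
have h A1 A2 : measurable A1 -> measurable A2 -> distribution P X' (A1 `*` A2) =
    (distribution P X1' A1 * distribution P X2' A2)%E.
  by move=> mA1 mA2; exact: X12.
have := @product_measure_unique _ _ T1 T2 R (distribution P X1') (distribution P X2')
  (distribution P X') h D mD.
have -> : P [set w | D (X1 w, X2 w)] = distribution P X' D by [].
move=> <-; rewrite /product_measure1 ge0_integral_distribution//.
exact: (@measurable_fun_xsection _ _ T1 T2 R (distribution P X2') D mD).
Qed.

End independent_pair.

(** * Expectations of functions of a uniform variable *)

Section uniform_integral.
Context {R : realType} {d : measure_display} {Omega : measurableType d}.
Variable P : probability Omega R.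

Lemma probability_setD_null (E N : set Omega) : measurable E -> measurable N ->
  P N = 0%E -> P (E `\` N) = P E.
Proof.
move=> mE mN N0; have mEN := measurableI _ _ mE mN.
have EN0 : P (E `&` N) = 0%E.
  by apply/eqP; rewrite eq_le measure_ge0 andbT -N0 le_measure// inE.
by rewrite [RHS](measureDI P mE mN) [X in (_ + X)%E]EN0 adde0.
Qed.

Lemma ge0_integral_uniform (X : Omega -> R) (u : R) (h : R -> \bar R) :
  0 < u -> measurable_fun setT X ->
  (forall x, 0 <= x <= u -> P [set w | X w <= x] = (x / u)%:E) ->
  measurable_fun setT h -> (forall x, 0 <= h x)%E ->
  (\int[P]_w h (X w) = (u^-1)%:E * \int[lebesgue_measure]_(t in `[0%R, u]) h t)%E.
Proof.
move=> u0 mX hX mh h0.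
have mi : measurable (`[0, u]%classic : set R) by [].
have u0' : 0 <= u^-1 by rewrite invr_ge0 ltW.
have mpre (A : set R) : measurable A -> measurable (X @^-1` A).
  by move=> mA; rewrite -[X in measurable X]setTI; exact: mX.
(* Outcomes outside [[0, u]] are possible but null. They are removed first, since the law of [X] is
   a multiple of Lebesgue measure only on subsets of [[0, u]]. *)
have N0 : P (X @^-1` ~` `[0, u]) = 0%E.
  rewrite (uniform_law P X u)//; last exact: measurableC.
  by rewrite setICl measure0 mule0.
have mN : measurable (X @^-1` ~` `[0, u]) by apply: mpre; exact: measurableC.
rewrite (ge0_negligible_integral mN _ _ _ N0)//; last exact: measurableT_comp.
rewrite setTD preimage_setC setCK.
rewrite -(@ge0_integral_pushforward _ _ _ (measurableTypeR R) _ X)//; last first.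
  exact: measurable_funTS.
rewrite (eq_measure_integral (mscale (NngNum u0') lebesgue_measure)); last first.
  move=> A mA AI; apply: etrans (uniform_law P X u u0 mX hX A mA) _.
  by rewrite (setIidl AI).
by rewrite ge0_integral_mscale//; exact: measurable_funTS.
Qed.

End uniform_integral.

(* For bounded p and x >= 0: exactly j parts exceed x.  At x = 1/t this is the
   event in S_j(t). *)
Definition exceeding {R : realType} (p : nat -> R) (j : nat) (x : R) : Prop :=
  kth_part p j.+1 <= x /\ (j = 0%N \/ x < kth_part p j).

(** * Events fixing the exact number of parts above a level *)

Section exceeding.
Context {R : realType}.

Lemma exceedingP (p : nat -> R) (M x : R) j : (forall i, p i <= M) -> 0 <= x ->
  exceeding p j x <-> atleast p x j /\ ~ atleast p x j.+1.
Proof.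
move=> pM x0; rewrite /exceeding (bounded_kth_part_leP p M j.+1)//.
have [->|j0] := eqVneq j 0%N.
  by split=> [[h _]|[_ h]]; split => //; [exists [::]|left].
have hj : x < kth_part p j <-> atleast p x j.
  rewrite ltNge; split=> [/negP h|h].
    by apply: contrapT => /(bounded_kth_part_leP p M j x pM); rewrite lt0n => /(_ j0 x0).
  by apply/negP => /(bounded_kth_part_leP p M j x pM); rewrite lt0n => /(_ j0 x0).
split=> [[h1 [/eqP|/hj]]|[/hj h1 h2]]; rewrite ?(negbTE j0)//.
by split => //; right.
Qed.

Lemma exceeding_inj (p : nat -> R) (M x : R) i j : (forall i, p i <= M) -> 0 <= x ->
  exceeding p i x -> exceeding p j x -> i = j.
Proof.
move=> pM x0 /(exceedingP p M x i pM x0)[i1 i2] /(exceedingP p M x j pM x0)[j1 j2].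
apply/eqP; rewrite eqn_leq; apply/andP; split; rewrite leqNgt; apply/negP => h.
  by apply: j2; exact: atleast_count_leq i1.
by apply: i2; exact: atleast_count_leq j1.
Qed.

Lemma measurable_exceeding {d} {T : measurableType d} (p : T -> nat -> R) (x : T -> R) j :
  (forall i, measurable_fun setT (p ^~ i)) -> measurable_fun setT x ->
  measurable [set w | exceeding (p w) j (x w)].
Proof.
move=> mp mx.
have mk i : measurable [set w | kth_part (p w) i <= x w] by exact: measurable_kth_part_le.
rewrite (_ : [set w | _] = [set w | kth_part (p w) j.+1 <= x w] `&`
  ([set w | j = 0%N] `|` ~` [set w | kth_part (p w) j <= x w])); last first.
  apply/seteqP; split => w /=; rewrite /exceeding ltNge => -[h1 h2]; split => //.
    by case: h2 => [|/negP]; [left|right].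
  by case: h2 => [|/negP]; [left|right].
apply: measurableI => //; apply: measurableU; last exact: measurableC.
by have [->|/eqP j0] := eqVneq j 0%N;
  [rewrite (_ : [set _ | _] = setT)|rewrite (_ : [set _ | _] = set0)] => //;
  apply/seteqP; split.
Qed.

End exceeding.

(** * The partition as a function of the joint sequence, and its shifts *)

Section parts.
Context {R : realType}.

(* [Apart U Bs w] is [parts y] for the joint sequence y of the U's and B's:
   y (inl i, 0) = U_i and y (inr i, j) = B^(i)_j. *)
Definition parts (y : (nat + nat) * nat -> R) (ij : nat * nat) : R :=
  y (inl ij.1, 0%N) * (\prod_(r < ij.1) (1 - y (inl (val r), 0%N))) * y (inr ij.1, ij.2).

Lemma measurable_parts {d} {T : measurableType d} (X : T -> (nat + nat) * nat -> R) ij :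
  (forall c, measurable_fun setT (X ^~ c)) -> measurable_fun setT (fun w => parts (X w) ij).
Proof.
move=> mX; apply: measurable_funM => //; apply: measurable_funM => //.
elim: ij.1 => [|n IH].
  rewrite (_ : (fun w => _) = cst 1); first exact: measurable_cst.
  by apply/funext => w; rewrite big_ord0.
rewrite (_ : (fun w => _) = (fun w =>
  (\prod_(r < n) (1 - X w (inl (val r), 0%N))) * (1 - X w (inl n, 0%N)))).
  by apply: measurable_funM => //; exact: measurable_funB.
by apply/funext => w; rewrite big_ord_recr.
Qed.

(** [shift_unif] discards U_0 alone and [shift_blocks] then discards B^(0); their composite is
    [shift_all], the family from which A' is built. *)
Definition shift_all (x : nat + nat) : nat + nat :=
  match x with inl i => inl i.+1 | inr i => inr i.+1 end.
Definition shift_unif (x : nat + nat) : nat + nat :=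
  match x with inl i => inl i.+1 | inr i => inr i end.
Definition shift_blocks (x : nat + nat) : nat + nat :=
  match x with inl i => inl i | inr i => inr i.+1 end.

End parts.

(** * The pathwise recursion *)

Section pointwise.
Context {R : realType}.
Variables (y : (nat + nat) * nat -> R).
Hypothesis y01 : forall i, 0 < y (inl i, 0%N) < 1.
Hypothesis y1 : forall i j, y (inr i, j) <= 1.

Lemma parts_le1 ij : parts y ij <= 1.
Proof.
rewrite /parts; set v := _ * \prod_(_ < _) _.
suff /andP[v0 v1] : 0 <= v <= 1.
  by apply: le_trans v1; rewrite ler_piMr.
have hr i : 0 <= 1 - y (inl i, 0%N) <= 1.
  by have /andP[/ltW ? /ltW ?] := y01 i; rewrite subr_ge0 gerBl; apply/andP.
have p0 : 0 <= \prod_(r < ij.1) (1 - y (inl (val r), 0%N)).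
  by apply: prodr_ge0 => i _; have /andP[] := hr i.
have p1 : \prod_(r < ij.1) (1 - y (inl (val r), 0%N)) <= 1.
  by apply: prodr_ile1 => i _; exact: hr.
have /andP[/ltW a0 /ltW a1] := y01 ij.1.
by rewrite mulr_ge0//= mulr_ile1.
Qed.

Lemma parts_recursion (u : R) k : 0 < u -> (0 < k)%N ->
  kth_part (parts y) k <= u^-1 <->
  exists2 j, (j < k)%N &
    exceeding (fun i => y (inr 0%N, i)) j (u * y (inl 0%N, 0%N))^-1 /\
    kth_part (parts (fun c => y (shift_all c.1, c.2))) (k - j) <=
      (u - u * y (inl 0%N, 0%N))^-1.
Proof.
move=> u0 k0; pose t := y (inl 0%N, 0%N).
pose y' (c : (nat + nat) * nat) := y (shift_all c.1, c.2); rewrite -/t -/y'.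
have /andP[t0 t1] : 0 < t < 1 := y01 0.
have t1' : 0 < 1 - t by rewrite subr_gt0.
rewrite (bounded_kth_part_leP _ 1 k)//; [|exact: parts_le1|by rewrite invr_ge0 ltW].
rewrite no_atleast_splitP.
have E0 : (fun j => parts y (0%N, j)) = (fun j => t * y (inr 0%N, j)).
  by apply/funext => j; rewrite /parts big_ord0 mulr1.
have E1 : (fun ij => parts y (ij.1.+1, ij.2)) = (fun ij => (1 - t) * parts y' ij).
  apply/funext => -[i j]; rewrite /parts/= big_ord_recl/= -/t.
  rewrite !mulrA; congr (_ * _); rewrite [(1 - t) * _]mulrC; congr (_ * _).
have x0 : 0 <= (u * t)^-1 by rewrite invr_ge0 mulr_ge0// ltW.
have x1 : 0 <= (u - u * t)^-1.
  by rewrite invr_ge0 -{1}(mulr1 u) -mulrBr mulr_ge0// ltW.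
(* Multiplied by [1 - t], these are rows of [parts y], all at most 1. Any finite bound lets
   [kth_part] be read as a count. *)
have y'1 ij : parts y' ij <= (1 - t)^-1.
  rewrite -(ler_pM2l t1') mulfV ?gt_eqF//.
  have := parts_le1 (ij.1.+1, ij.2).
  by rewrite -[parts y _]/((fun ij => parts y (ij.1.+1, ij.2)) ij) E1.
have B0 a : atleast (fun j => parts y (0%N, j)) u^-1 a <->
    atleast (fun j => y (inr 0%N, j)) (u * t)^-1 a.
  by rewrite E0 atleast_scale// invfM.
have B1 a : atleast (fun ij => parts y (ij.1.+1, ij.2)) u^-1 a <->
    atleast (parts y') (u - u * t)^-1 a.
  by rewrite E1 atleast_scale// -{2}(mulr1 u) -mulrBr invfM.
have H j : (j < k)%N -> kth_part (parts y') (k - j) <= (u - u * t)^-1 <->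
    ~ atleast (parts y') (u - u * t)^-1 (k - j).
  by move=> jk; apply: (bounded_kth_part_leP _ (1 - t)^-1); rewrite ?subn_gt0.
split=> -[j jk].
  move=> [/B0 h1 h2 h3]; exists j => //; split.
    by apply/(exceedingP _ 1) => //; split => // /B0.
  by apply/H => // /B1.
move=> [/(exceedingP _ 1)[]// h1 h2 /H h3]; exists j => //; split.
- exact/B0.
- by move/B0.
- by move/B1; exact: h3.
Qed.

End pointwise.

(** * Probabilities and integral equations for the self-similar partition *)

Section self_similar.
Context {R : realType} {d : measure_display} {Omega : measurableType d}.
Variables (P : probability Omega R) (B : Omega -> nat -> R) (U : nat -> Omega -> R)
  (Bs : nat -> Omega -> nat -> R).
Hypotheses (hB : forall w j, B w j <= 1)
  (mB : forall j, measurable_fun setT (fun w => B w j))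
  (hU : forall i, uniform01 P (U i))
  (mBs : forall i j, measurable_fun setT (fun w => Bs i w j))
  (hBs : forall i, same_law P (Bs i) B)
  (hind : mutually_independent P (UB_family U Bs)).

Let Y := UB_family U Bs.
Let A := Apart U Bs.

Let mU i : measurable_fun setT (U i). Proof. by have [] := hU i. Qed.

Let mY i j : measurable_fun setT (fun w => Y i w j).
Proof. by case: i => i; [exact: mU|exact: mBs]. Qed.

Let mpre {d'} {T : measurableType d'} (X : Omega -> T) (E : set T) :
  measurable_fun setT X -> measurable E -> measurable (X @^-1` E).
Proof. by move=> mX mE; rewrite -[X in measurable X]setTI; exact: mX. Qed.

Lemma measurable_Apart ij : measurable_fun setT (fun w => A w ij).
Proof. by apply: (measurable_parts (block Y id)) => -[i j]; exact: mY. Qed.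

Lemma phiE k u : 0 < u -> (phi P A k u)%:E = P [set w | kth_part (A w) k <= u^-1].
Proof.
move=> u0; rewrite /phi leNgt u0 fineK// fin_num_measure//.
by apply: measurable_kth_part_le => //; exact: measurable_Apart.
Qed.

Lemma SfunE j x : (Sfun P B j x)%:E = P [set w | exceeding (B w) j x^-1].
Proof.
rewrite /Sfun fineK// fin_num_measure//.
exact: (@measurable_exceeding _ _ _ B (cst x^-1)).
Qed.

Let mRinv {d'} {T : measurableType d'} {f : T -> R} :
  measurable_fun setT f -> measurable_fun setT (fun z => (f z)^-1).
Proof. by move=> mf; apply: (measurableT_comp measurable_invr mf). Qed.

Lemma measurable_phi k : measurable_fun setT (phi P A k).
Proof.
(* The level becomes a coordinate: [phi] is the probability of the sections of one jointly
   measurable set. *)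
pose D := [set z : R * Omega | kth_part (A z.2) k <= z.1^-1].
have mD : measurable D.
  apply: measurable_kth_part_le; last exact: (mRinv measurable_fst).
  by move=> ij; apply: (measurableT_comp (measurable_Apart ij)).
apply: measurable_fun_ifT.
- by apply: measurable_fun_ler.
- exact: measurable_cst.
- apply: (measurableT_comp (fine_measurable measurableT)) => //.
  have := measurable_probability_xsection P (id : Omega -> Omega) (@measurable_id _ _ _) D mD.
  by congr measurable_fun; apply/funext => x; congr (P _); apply/seteqP; split => w;
    rewrite /= /xsection/= inE.
Qed.

Lemma measurable_Sfun j : measurable_fun setT (Sfun P B j).
Proof.
pose D := [set z : R * Omega | exceeding (B z.2) j z.1^-1].
have mD : measurable D.
  apply: measurable_exceeding; last exact: (mRinv measurable_fst).
  by move=> i; apply: (measurableT_comp (mB i)).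
apply: (measurableT_comp (fine_measurable measurableT)) => //.
have := measurable_probability_xsection P (id : Omega -> Omega) (@measurable_id _ _ _) D mD.
by congr measurable_fun; apply/funext => x; congr (P _); apply/seteqP; split => w;
  rewrite /= /xsection/= inE.
Qed.

Lemma phi_ge0 k u : 0 <= phi P A k u.
Proof. by rewrite /phi; case: ifP => // _; exact: fine_ge0. Qed.

Lemma Sfun_ge0 j x : 0 <= Sfun P B j x.
Proof. exact: fine_ge0. Qed.

Lemma same_law_measurable i (E : set (seq_space R nat)) : measurable E ->
  P (Bs i @^-1` E) = P (B @^-1` E).
Proof.
move=> mE.
apply: (@eq_law_pi_system R _ _ _ (seq_space R nat) P (cylinders R nat) erefl
  cylinders_setI_closed cylindersT (Bs i) B) => //.
- by apply: measurable_to_seq_space => j; exact: mBs.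
- by apply: measurable_to_seq_space => j; exact: mB.
- by move=> _ [s _ <-]; exact: hBs.
Qed.

(** The hypotheses on [U] and [Bs] constrain laws only, so the open interval and the bound by 1,
    transferred from [B], hold off a null set. *)
Lemma ae_good : {ae P, forall w, (forall i, 0 < U i w < 1) /\ (forall i j, Bs i w j <= 1)}.
Proof.
have h1 : {ae P, forall w, forall i, 0 < U i w < 1}.
  apply: ae_foralln => i; pose E := U i @^-1` `]0, 1[%classic.
  have mE : measurable E by apply: (mpre (U i)).
  have E1 : P E = 1%E.
    rewrite /E (uniform_law P _ 1)//; last by move=> x x01; rewrite (hU i).2 ?divr1.
    rewrite setIidl; last exact: subset_itv_oo_cc.
    by rewrite lebesgue_measure_itv/= lte_fin ltr01 -EFinB -EFinM subr0 invr1 mulr1.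
  have N0 : P (~` E) = 0%E by rewrite probability_setC// E1 subee.
  exists (~` E); split => //; first exact: measurableC.
have h2 : {ae P, forall w, forall i, forall j, Bs i w j <= 1}.
  apply: ae_foralln => i; apply: ae_foralln => j.
  pose E := [set y : seq_space R nat | 1 < y j].
  have mE : measurable E.
    rewrite (_ : E = ~` [set y : seq_space R nat | y j <= 1]); last first.
      by apply/seteqP; split => y /=; rewrite /E/= ltNge => /negP.
    apply: measurableC.
    have := measurable_fun_ler (@measurable_coord R nat j)
      (measurable_cst (1 : R)) => /(_ measurableT [set true]).
    by rewrite setTI; apply.
  have N0 : P (Bs i @^-1` E) = 0%E.
    rewrite (same_law_measurable i E mE) (_ : _ @^-1` _ = set0) ?measure0//.
    by apply/seteqP; split => w //=; rewrite /E/= ltNge hB.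
  exists (Bs i @^-1` E); split => //.
  - by apply: (@mpre _ (seq_space R nat) (Bs i)) => //;
      apply: measurable_to_seq_space => j'; exact: mBs.
  - by move=> w /= /negP; rewrite -ltNge.
by apply: (filterS2 _ _ h1 h2) => w ? ?; split.
Qed.

Lemma uniform_scale u x : 0 < u -> 0 <= x <= u ->
  P [set w | u * U 0 w <= x] = (x / u)%:E.
Proof.
move=> u0 /andP[x0 xu]; rewrite -((hU 0).2 (x / u)); last first.
  by rewrite divr_ge0 ?(ltW u0)//= ler_pdivrMr// mul1r.
by congr (P _); apply/seteqP; split => w /=; rewrite ler_pdivlMr// mulrC.
Qed.

Lemma uniform_scale_reflect u x : 0 < u -> 0 <= x <= u ->
  P [set w | u - u * U 0 w <= x] = (x / u)%:E.
Proof.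
move=> u0 /andP[x0 xu].
have y0 : 0 <= x / u by rewrite divr_ge0// ltW.
have y1 : x / u <= 1 by rewrite ler_pdivrMr// mul1r.
rewrite (_ : [set w | _] = U 0 @^-1` `[1 - x / u, +oo[); last first.
  have E w : (u - u * U 0 w <= x) = (1 - x / u <= U 0 w).
    by rewrite lerBlDr -lerBlDl -ler_pdivrMl// mulrBr mulVf ?gt_eqF// [u^-1 * x]mulrC.
  by apply/seteqP; split => w /=; rewrite in_itv/= andbT E.
rewrite (uniform_law P _ 1)//; last by move=> z z01; rewrite (hU 0).2 ?divr1.
rewrite (_ : _ `&` _ = `[1 - x / u, 1]%classic); last first.
  apply/seteqP; split => z /=; rewrite !in_itv/= andbT.
    by move=> [-> /andP[_ ->]].
  by move=> /andP[h ->]; rewrite h andbT (le_trans _ h)// subr_ge0.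
rewrite lebesgue_measure_itv/= lte_fin ltrBlDr ltrDl.
have [y_gt0|] := ltP 0 (x / u).
  by rewrite -EFinB -EFinM invr1 mul1r opprB addrC subrK.
by move=> h; rewrite mule0; congr EFin; apply/eqP; rewrite eq_le h y0.
Qed.

(** The [j]-th term of the recursion with frozen levels, as a set of sequences from which U_0 is
    already absent; this makes it independent of T. *)
Definition split_event j m (s x : R) : set (seq_space R ((nat + nat) * nat)%type) :=
  [set y | exceeding (fun i => y (inr 0%N, i)) j s /\
     kth_part (parts (fun c => y (shift_blocks c.1, c.2))) m <= x].

Let shift_blocks_unif w : (fun c : (nat + nat) * nat =>
  block Y shift_unif w (shift_blocks c.1, c.2)) = block Y shift_all w.
Proof. by apply/funext => -[[i|i] n]. Qed.

Lemma probability_section j m s x :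
  P (block Y shift_unif @^-1` split_event j m s x) =
  (P [set w | exceeding (B w) j s] * P [set w | (kth_part (A w) m <= x)%R])%E.
Proof.
pose g0 (_ : unit) : nat + nat := inr 0%N.
pose S1 := [set y : seq_space R (unit * nat)%type | exceeding (fun i => y (tt, i)) j s].
pose S2 := [set y : seq_space R ((nat + nat) * nat)%type | kth_part (parts y) m <= x].
have mS1 : measurable S1.
  apply: (measurable_exceeding _ (cst s)) => // i.
  exact: (@measurable_coord R (unit * nat)%type (tt, i)).
have mS2 : measurable S2.
  apply: (measurable_kth_part_le _ _ (cst x)) => // ij.
  apply: (measurable_parts (fun y : seq_space R ((nat + nat) * nat)%type => y)) => c.
  exact: (@measurable_coord R ((nat + nat) * nat)%type c).
have -> : block Y shift_unif @^-1` split_event j m s x =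
    block Y g0 @^-1` S1 `&` block Y shift_all @^-1` S2.
  by apply/seteqP; split => w; rewrite /split_event/= shift_blocks_unif.
rewrite (block_indep P)//; last by move=> [] [].
congr (_ * _)%E.
  pose S := [set y : seq_space R nat | exceeding y j s].
  have mS : measurable S.
    by apply: (measurable_exceeding _ (cst s)) => // i; exact: measurable_coord.
  exact: (same_law_measurable 0%N S mS).
(* This is the equality in law of A' and A: the shifted family has the joint law of the original
   one. *)
rewrite (block_same_law P Y shift_all id)//; first by move=> [i|i] [i'|i'] //= [->].
move=> [i|i] /=; first exact: same_law_uniform01.
by move=> E; rewrite hBs hBs.
Qed.

Lemma phi_convolution k u : (0 < k)%N -> 0 < u ->
  (phi P A k u)%:E = (\sum_(j < k) (u^-1)%:E *
    \int[lebesgue_measure]_(t in `[0%R, u%R])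
      (Sfun P B j t * phi P A (k - j) (u - t))%:E)%E.
Proof.
move=> k0 u0; rewrite phiE//.
pose T w := u * U 0 w.
have mT : measurable_fun setT T by exact: measurable_funM.
have mW : measurable_fun setT (block Y shift_unif) by exact: measurable_block.
pose D (j : nat) := [set z : R * seq_space R ((nat + nat) * nat)%type |
  split_event j (k - j) z.1^-1 (u - z.1)^-1 z.2].
have mcoord c : measurable_fun setT
    (fun z : R * seq_space R ((nat + nat) * nat)%type => z.2 c).
  exact: (measurableT_comp (@measurable_coord R ((nat + nat) * nat)%type c)).
have mD j : measurable (D j).
  rewrite (_ : D j =
      [set z | exceeding ((fun z i => z.2 (inr 0%N, i)) z) j (z.1^-1)] `&`
      [set z | kth_part (parts ((fun z c => z.2 (shift_blocks c.1, c.2)) z)) (k - j)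
         <= (u - z.1)^-1])//.
  apply: measurableI.
    apply: measurable_exceeding => [i|]; first exact: mcoord.
    by apply: (mRinv (f := fst)); exact: measurable_fst.
  apply: measurable_kth_part_le => [ij|].
    by apply: measurable_parts => c; exact: mcoord.
  by apply: mRinv; exact: measurable_funB.
pose E j := [set w | D j (T w, block Y shift_unif w)].
have mE j : measurable (E j).
  apply: (mpre (fun w => (T w, block Y shift_unif w)) (D j)); last exact: mD.
  exact: measurable_fun_pair.
have mA : measurable [set w | kth_part (A w) k <= u^-1].
  by apply: measurable_kth_part_le => //; exact: measurable_Apart.
have [N [mN N0 goodN]] := ae_good.
apply: etrans (esym (probability_setD_null P _ N mA mN N0)) _.
have good w : ~ N w -> (forall i, 0 < U i w < 1) /\ (forall i j, Bs i w j <= 1).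
  by move=> nN; apply: contrapT => ng; exact: nN (goodN w ng).
have recw w : ~ N w -> kth_part (A w) k <= u^-1 <-> exists2 j, (j < k)%N & E j w.
  move=> /good[h1 h2].
  have := parts_recursion (block Y id w) h1 h2 u k u0 k0.
  by rewrite /E/D/= /split_event/= shift_blocks_unif.
have -> : [set w | kth_part (A w) k <= u^-1] `\` N = \big[setU/set0]_(j < k) (E j `\` N).
  rewrite -(bigcup_mkord _ (fun j => E j `\` N)); apply/seteqP; split => w.
    by move=> [/[swap] nN /(recw w nN)[j jk Ej]]; exists j.
  by move=> [j jk [Ej nN]]; split => //; apply/(recw w nN); exists j.
rewrite measure_semi_additive_ord//; first last.
- by apply: bigsetU_measurable => j _; exact: measurableD.
(* Two of these events cannot share an outcome, since each fixes the exact count in B^(0) at the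
   same level 1/T. *)
- apply/trivIsetP => i j _ _ /eqP ij; apply/seteqP; split => // w [[[Ei _] nN] [[Ej _] _]].
  have [h1 h2] := good w nN.
  apply: ij; apply: val_inj; apply: (exceeding_inj _ 1 (T w)^-1 _ _ _ _ Ei Ej).
    by move=> m; exact: h2.
  by have /andP[/ltW U0 _] := h1 0%N; rewrite invr_ge0 mulr_ge0// ltW.
- by move=> j; exact: measurableD.
apply: eq_bigr => j _.
transitivity (P (E j)); first exact: probability_setD_null.
(* T is a function of the one-member block consisting of U_0, which is disjoint from the block
   selected by [shift_unif]. *)
have indep (A1 : set R) (A2 : set (seq_space R ((nat + nat) * nat)%type)) :
    measurable A1 -> measurable A2 ->
    P (T @^-1` A1 `&` block Y shift_unif @^-1` A2) =
    (P (T @^-1` A1) * P (block Y shift_unif @^-1` A2))%E.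
  move=> mA1 mA2.
  pose A1' := [set y : seq_space R (unit * nat)%type | A1 (u * y (tt, 0%N))].
  have mA1' : measurable A1'.
    have := measurable_funM (measurable_cst u) (@measurable_coord R (unit * nat)%type (tt, 0%N)).
    by move=> /(_ measurableT A1 mA1); rewrite setTI.
  by apply: (@block_indep _ _ _ P unit (nat + nat)%type _ Y (fun=> inl 0%N) shift_unif A1' A2)
    => // -[] [].
apply: etrans (probability_independent_pair P T _ mT mW (D j) indep (mD j)) _.
have mh := measurable_probability_xsection P _ mW _ (mD j).
rewrite (ge0_integral_uniform P T u (fun t => P (block Y shift_unif @^-1` xsection (D j) t)))//;
  last by move=> x x0u; exact: uniform_scale.
congr (_ * _)%E.
(* The endpoint [t = u] is dropped: there the event has level 0, the inverse of 0, whereas [phi] at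
   0 is 1 by convention. *)
rewrite -integral_itv_bndo_bndc; last exact: measurable_funTS.
rewrite -[RHS]integral_itv_bndo_bndc; last first.
  apply: measurable_funTS; apply/measurable_EFinP; apply: measurable_funM.
    exact: measurable_Sfun.
  apply: (measurableT_comp (measurable_phi _)).
  exact: measurable_funB.
apply: eq_integral => t; rewrite inE/= in_itv/= => /andP[t0 tu].
rewrite EFinM phiE ?subr_gt0// SfunE -probability_section.
by congr (P _); apply/seteqP; split => w /=; rewrite /xsection/= inE.
Qed.

(** Both T and u - T are uniform on [[0, u]], so after division by [u] the two integrals become the
    same expectation; [K] undoes the division. *)
Lemma ge0_integral_reflect (u : R) (h : R -> \bar R) : 0 < u ->
  measurable_fun setT h -> (forall x, 0 <= h x)%E ->
  (\int[lebesgue_measure]_(t in `[0%R, u]) h t =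
   \int[lebesgue_measure]_(t in `[0%R, u]) h (u - t)%R)%E.
Proof.
move=> u0 mh h0.
have K (I : \bar R) : (u%:E * ((u^-1)%:E * I) = I)%E.
  by rewrite muleA -EFinM divff ?gt_eqF// mul1e.
rewrite -[LHS]K -[RHS]K; congr (_ * _)%E.
have mT : measurable_fun setT (fun w => u * U 0 w) by exact: measurable_funM.
rewrite -(ge0_integral_uniform P (fun w => u * U 0 w))//; last first.
  by move=> x; exact: uniform_scale.
rewrite -(ge0_integral_uniform P (fun w => u - u * U 0 w) u (fun t => h (u - t)))//; first last.
- by apply: (measurableT_comp mh); exact: measurable_funB.
- by move=> x; exact: uniform_scale_reflect.
- exact: measurable_funB.
by apply: eq_integral => w _; rewrite subKr.
Qed.

(** The half-open interval mirrors the non-strict and the strict bound in [exceeding]. The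
    conventions agree at vanishing parts: a zero B_{j+1} imposes nothing beyond [0 <= y], and a zero
    B_j with [j > 0] makes both sides false. *)
Lemma limits_exceedingP (u y : R) j w : 0 < u ->
  (lo_lim B u j w <= y < hi_lim B u j w) <->
  (0 <= y < u) /\ exceeding (B w) j (u - y)^-1.
Proof.
move=> u0; rewrite /lo_lim /hi_lim /exceeding.
set b' := kth_part _ j.+1; set b := kth_part _ j.
have b'0 : 0 <= b' by exact: kth_part_ge0.
have b0 : 0 <= b by exact: kth_part_ge0.
have hlo : 0 <= y < u -> ((if 0 < b' then Num.max (u - b'^-1) 0 else 0) <= y) =
    (b' <= (u - y)^-1).
  move=> /andP[y0 yu]; have uy : 0 < u - y by rewrite subr_gt0.
  case: ifPn => [b'p|]; last first.
    by rewrite -leNgt => b'n; rewrite y0 (le_trans b'n)// invr_ge0 ltW.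
  by rewrite ge_max y0 andbT lerBlDr -lerBlDl invf_pge.
have hhi : 0 <= y < u -> (y < (if j == 0%N then u else if 0 < b then u - b^-1 else -1)) <->
    (j = 0%N \/ (u - y)^-1 < b).
  move=> /andP[y0 yu]; have uy : 0 < u - y by rewrite subr_gt0.
  case: ifPn => [/eqP j0|j0]; first by split => // _; left.
  case: ifPn => [bp|]; last first.
    rewrite -leNgt => bn; split; first by rewrite ltNge (le_trans _ y0)// lerN10.
    move=> [/eqP|]; first by rewrite (negbTE j0).
    by move=> /lt_le_trans/(_ bn); rewrite invr_lt0 ltNge ltW.
  rewrite ltrBrDr -ltrBrDl invf_plt//.
  by split => [|[/eqP|//]]; [right|rewrite (negbTE j0)].
have lo0 : 0 <= (if 0 < b' then Num.max (u - b'^-1) 0 else 0).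
  by case: ifP => // _; rewrite le_max lexx orbT.
have hiu : (if j == 0%N then u else if 0 < b then u - b^-1 else -1) <= u.
  case: ifP => // _; case: ifP => [bp|_]; first by rewrite gerBl invr_ge0.
  by rewrite (le_trans _ (ltW u0))// lerN10.
split=> [/andP[h1 h2]|[y0u [h1 h2]]].
  have y0u : 0 <= y < u by rewrite (le_trans lo0 h1) (lt_le_trans h2 hiu).
  by split => //; rewrite -hlo//; split => //; apply/hhi.
by rewrite hlo// h1/=; apply/hhi.
Qed.

Lemma integral_limits (u : R) j m : 0 < u ->
  (\int[P]_w \int[lebesgue_measure]_(y in `[(lo_lim B u j w)%R, (hi_lim B u j w)%R])
     (phi P A m y)%:E =
   \int[lebesgue_measure]_(t in `[0%R, u%R])
      (Sfun P B j t * phi P A m (u - t))%:E)%E.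
Proof.
move=> u0.
(* The random interval becomes a fixed measurable region of the product space, so Tonelli applies to
   [phi] times its indicator. Integrating over the outcome at fixed [y] leaves S_j(u - y), and the
   reflection [t = u - y] gives the convolution. *)
pose D := [set z : Omega * measurableTypeR R | 0 <= z.2 < u /\ exceeding (B z.1) j (u - z.2)^-1].
have mz2 : measurable_fun setT (fun z : Omega * measurableTypeR R => z.2 : R).
  exact: measurable_snd.
have mD : measurable D.
  rewrite (_ : D = [set z | 0 <= z.2 < u] `&`
      [set z | exceeding ((fun z => B z.1) z) j (u - z.2)^-1])//.
  apply: measurableI.
    have : measurable (snd @^-1` `[0, u[ : set (Omega * measurableTypeR R)).
      by rewrite -[X in measurable X]setTI; apply: mz2.
    by congr measurable; apply/seteqP; split => z /=; rewrite in_itv.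
  apply: measurable_exceeding => [i|].
    exact: (measurableT_comp (mB i) measurable_fst).
  by apply: mRinv; exact: measurable_funB.
pose f (z : Omega * measurableTypeR R) := ((phi P A m z.2)%:E * (\1_D z)%:E)%E.
have mf : measurable_fun setT f.
  apply: emeasurable_funM; apply/measurable_EFinP.
    exact: (measurableT_comp (measurable_phi m) mz2).
  exact: measurable_indic.
have f0 z : (0 <= f z)%E by rewrite mule_ge0// lee_fin ?phi_ge0.
transitivity (\int[P]_w \int[lebesgue_measure]_y f (w, y))%E.
  apply: eq_integral => w _; rewrite -integral_itv_bndo_bndc; last first.
    by apply: measurable_funTS; apply/measurable_EFinP; exact: measurable_phi.
  rewrite integral_mkcond; apply: eq_integral => y _; rewrite patchE /f indicE.
  have -> : ((w, y) \in D) = (y \in `[lo_lim B u j w, hi_lim B u j w[%classic).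
    by apply/idP/idP; rewrite !inE/= in_itv/= => /(limits_exceedingP _ _ _ _ u0).
  by case: ifP => _; rewrite ?mule1 ?mule0.
rewrite (@fubini_tonelli _ _ Omega (measurableTypeR R) R P lebesgue_measure f)//.
rewrite (ge0_integral_reflect u (fun t => (Sfun P B j t * phi P A m (u - t))%:E))//; first last.
- by move=> x; rewrite lee_fin mulr_ge0 ?phi_ge0 ?Sfun_ge0.
- apply/measurable_EFinP; apply: measurable_funM; first exact: measurable_Sfun.
  by apply: (measurableT_comp (measurable_phi m)); exact: measurable_funB.
rewrite -integral_itv_bndo_bndc; last first.
  apply: measurable_funTS; apply/measurable_EFinP; apply: measurable_funM.
    by apply: (measurableT_comp (measurable_Sfun j)); exact: measurable_funB.
  under eq_fun do rewrite subKr; exact: measurable_phi.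
rewrite [RHS]integral_mkcond; apply: eq_integral => y _; rewrite patchE subKr /f/=.
have mDy : measurable [set w | D (w, y)].
  have := @measurable_ysection _ _ _ _ D y mD.
  by congr measurable; apply/seteqP; split => w; rewrite /ysection/= inE.
have E w : \1_D (w, y) = \1_[set w | D (w, y)] w :> R.
  by rewrite !indicE; congr (_ %:R); apply/idP/idP; rewrite !inE.
under eq_integral do rewrite E.
rewrite ge0_integralZl//; last 2 first.
- by apply/measurable_EFinP; exact: measurable_indic.
- by rewrite lee_fin phi_ge0.
rewrite integral_indic// setIT.
case: ifPn => [|]; rewrite ?inE ?notin_setE/= in_itv/= => yu.
  rewrite mulrC EFinM SfunE; congr (_ * P _)%E.
  by apply/seteqP; split => w /=; rewrite /D/= ?yu// => -[].
rewrite (_ : [set w | _] = set0) ?measure0 ?mule0//.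
by apply/seteqP; split => w // -[].
Qed.

End self_similar.

Theorem mainTheorem7 (R : realType) (d : measure_display)
  (Omega : measurableType d) (P : probability Omega R)
  (B : Omega -> nat -> R) (U : nat -> Omega -> R)
  (Bs : nat -> Omega -> nat -> R) :
  (forall w, partition_of_unity (B w)) ->
  (forall j, measurable_fun setT (fun w => B w j)) ->
  (forall i, uniform01 P (U i)) ->
  (forall i j, measurable_fun setT (fun w => Bs i w j)) ->
  (forall i, same_law P (Bs i) B) ->
  mutually_independent P (UB_family U Bs) ->
  forall (k : nat) (u : R), (1 <= k)%N -> 0 < u ->
  (phi P (Apart U Bs) k u)%:E =
     ((u^-1)%:E * \sum_(j < k)
       \int[P]_w (\int[lebesgue_measure]_(y in `[(lo_lim B u j w)%R, (hi_lim B u j w)%R])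
                    (phi P (Apart U Bs) (k - j) y)%:E))%E
  /\
  (u * phi P (Apart U Bs) k u)%:E =
     (\sum_(j < k)
       \int[lebesgue_measure]_(t in `[0%R, u%R])
          (Sfun P B j t * phi P (Apart U Bs) (k - j) (u - t))%:E)%E.
Proof.
move=> hB mB hU mBs hBs hind k u k0 u0.
have hB1 w j : B w j <= 1.
  have [B0 Bsum] := hB w; rewrite -lee_fin -Bsum.
  (* A part of index [j] is bounded by the partial sum of the first [j + 1] terms, hence by the
     total mass 1. *)
  apply: le_trans (nneseries_lim_ge j.+1 _); last by move=> i _; rewrite lee_fin.
  by rewrite big_nat_recr//= leeDr// sume_ge0// => i _; rewrite lee_fin.
have conv : (phi P (Apart U Bs) k u)%:E = ((u^-1)%:E * \sum_(j < k)
    \int[lebesgue_measure]_(t in `[0%R, u])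
      (Sfun P B j t * phi P (Apart U Bs) (k - j) (u - t))%:E)%E.
  rewrite (phi_convolution P B)// ge0_sume_distrr// => j _.
  apply: integral_ge0 => t _.
  by rewrite lee_fin mulr_ge0 ?(phi_ge0 P) ?(Sfun_ge0 P).
split.
  rewrite conv; congr (_ * _)%E; apply: eq_bigr => j _.
  by rewrite (integral_limits P B).
by rewrite EFinM conv muleA -EFinM divff ?gt_eqF// mul1e.
Qed.
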